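(* Let $n,m\ge1$ be integers and let $T\in B(\mathcal H)$ be Drazin invertible. Then: (i) $T\in[(n,m)DN]$ and $T\in[(n+1,m)DN]$ both hold if and only if $T\in[(k,m)DN]$ for all integers $k\ge1$; (ii) $T\in[(n,m)DN]$ and $T\in[(n,m+1)DN]$ both hold if and only if $T\in[(n,k)DN]$ for all integers $k\ge1$.
   Context: $\mathcal H$ is a complex infinite dimensional Hilbert space and $B(\mathcal H)$ is the algebra of bounded linear operators on $\mathcal H$; $[X,Y]=XY-YX$ and $T^{*m}=(T^* )^m$. An operator $T\in B(\mathcal H)$ is Drazin invertible if there is $T_d\in B(\mathcal H)$ (the Drazin inverse) with $[T_d,T]=0$, $T_d^2T=T_d$ and $T^{p+1}T_d=T^p$ for some integer $p\ge1$ (if $T$ is invertible, $T_d=T^{-1}$). For positive integers $r,s$, $T\in[(r,s)DN]$ means that $T$ is Drazin invertible and $[T_d^r,T^{*s}]=0$. *)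

(* Defs.v *)
From HB Require Import structures.
From mathcomp Require Import all_boot all_order all_algebra.
From mathcomp Require Import complex ring.
From mathcomp Require Import boolp classical_sets functions reals.
From mathcomp Require Import topology normedtype sequences.

Set Implicit Arguments.
Unset Strict Implicit.
Unset Printing Implicit Defensive.

Import Order.TTheory GRing.Theory Num.Theory.
Import numFieldNormedType.Exports.
Local Open Scope classical_set_scope.
Local Open Scope ring_scope.

(* [inner] is linear in its first argument and conjugate-linear in the second;
   the norm, and with it completeness, is that of the underlying normed module
   over R[i]. *)
HB.mixin Record CompleteNormedModule_isHilbert (R : realType) H
    & CompleteNormedModule R[i] H := {
  inner : {dot H for (@Num.conj R[i])};
  innerE : forall x : H, `|x| ^+ 2 = inner x x
}.

#[short(type="hilbertType")]
HB.structure Definition Hilbert (R : realType) :=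
  {H of CompleteNormedModule R[i] H & CompleteNormedModule_isHilbert R H}.

Arguments inner {R s} : rename.

Definition infinite_dimensional (R : realType) (H : hilbertType R) : Prop :=
  ~ exists (n : nat) (e : 'I_n -> H),
      forall x : H, exists c : 'I_n -> R[i], x = \sum_(i < n) c i *: e i.

Section BoundedOperators.
Variables (R : realType) (H : hilbertType R).

Definition bounded_linear : {pred H -> H} := [pred f : H -> H |
  `[< linear f /\ exists M : R[i], forall x, `|f x| <= M * `|x| >]].

Lemma bounded_linearP (f : H -> H) :
  f \in bounded_linear <->
  linear f /\ exists2 M : R[i], 0 <= M & forall x, `|f x| <= M * `|x|.
Proof.
rewrite inE; split=> [[lf [M fM]]|[lf [M _ fM]]]; last first.
  by split=> //; exists M.
split=> //; have [M0|M0] := boolP (0 <= M); first by exists M.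
exists 0 => // x; have [->|x0] := eqVneq x 0.
  by have := fM 0; rewrite normr0 !mulr0.
suff : 0 <= M by rewrite (negbTE M0).
by rewrite -(pmulr_lge0 _ (_ : 0 < `|x|)) ?normr_gt0// (le_trans _ (fM x)).
Qed.

Record bop := BOp { bop_fun :> H -> H; _ : bop_fun \in bounded_linear }.

HB.instance Definition _ := [isSub for bop_fun].
HB.instance Definition _ := [Choice of bop by <:].

Lemma bop_ext (S T : bop) : S =1 T -> S = T.
Proof. by move=> ST; apply/val_inj/funext. Qed.

Fact bounded_linear_zmod : zmod_closed bounded_linear.
Proof.
split=> [|f g /bounded_linearP[lf [M M0 fM]] /bounded_linearP[lg [N N0 gN]]].
  apply/bounded_linearP; split=> [a x y|]; first by rewrite /= scaler0 addr0.
  by exists 0 => // x; rewrite /= normr0 mul0r.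
have fgE z : (f - g) z = f z - g z by [].
apply/bounded_linearP; split=> [a x y|].
  by rewrite !fgE lf lg scalerBr opprD addrACA.
exists (M + N) => [|x]; first exact: addr_ge0.
by rewrite fgE mulrDl (le_trans (ler_normB _ _))// lerD.
Qed.
HB.instance Definition _ := GRing.isZmodClosed.Build _ _ bounded_linear_zmod.
HB.instance Definition _ := [SubChoice_isSubZmodule of bop by <:].

Fact bop_one_subproof : id \in bounded_linear.
Proof. by apply/bounded_linearP; split=> //; exists 1 => // x; rewrite mul1r. Qed.

Fact bop_mul_subproof (S T : bop) : S \o T \in bounded_linear.
Proof.
have /bounded_linearP[lS [M M0 SM]] := valP S.
have /bounded_linearP[lT [N N0 TN]] := valP T.
apply/bounded_linearP; split=> [a x y|]; first by rewrite /= lT lS.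
exists (M * N) => [|x]; first exact: mulr_ge0.
by rewrite /= (le_trans (SM _))// -mulrA ler_wpM2l.
Qed.

Definition bop_one : bop := BOp bop_one_subproof.
Definition bop_mul (S T : bop) : bop := BOp (bop_mul_subproof S T).

Lemma bop_linear (T : bop) : linear T.
Proof. by have /bounded_linearP[] := valP T. Qed.
HB.instance Definition _ (T : bop) := GRing.isLinear.Build _ _ _ _ T (bop_linear T).

Lemma bopD (S T : bop) x : (S + T) x = S x + T x. Proof. by []. Qed.

Fact bop_mulA : associative bop_mul. Proof. by move=> *; apply/bop_ext. Qed.
Fact bop_mul1 : left_id bop_one bop_mul. Proof. by move=> *; apply/bop_ext. Qed.
Fact bop_1mul : right_id bop_one bop_mul. Proof. by move=> *; apply/bop_ext. Qed.
Fact bop_mulDl : left_distributive bop_mul +%R.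
Proof. by move=> *; apply/bop_ext. Qed.
Fact bop_mulDr : right_distributive bop_mul +%R.
Proof. by move=> S T U; apply/bop_ext => x; exact: (raddfD S). Qed.

(* B(H) as a ring: multiplication is composition. Only a possibly-zero ring, as
   H is not assumed nontrivial here. *)
HB.instance Definition _ := GRing.Zmodule_isPzRing.Build bop
  bop_mulA bop_mul1 bop_1mul bop_mulDl bop_mulDr.

Lemma bopM (S T : bop) x : (S * T) x = S (T x). Proof. by []. Qed.
Lemma bop1 x : (1 : bop) x = x. Proof. by []. Qed.

End BoundedOperators.
Section Riesz.
Variables (R : realType) (H : hilbertType R).
Implicit Types (x y z : H).

Lemma innerDl x y z : inner (x + y) z = inner x z + inner y z.
Proof. exact: linearDl. Qed.
Lemma innerDr x y z : inner x (y + z) = inner x y + inner x z.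
Proof. exact: linearDr. Qed.
Lemma innerBr x y z : inner x (y - z) = inner x y - inner x z.
Proof. exact: linearBr. Qed.
Lemma innerZl (a : R[i]) x y : inner (a *: x) y = a * inner x y.
Proof. exact: linearZl_LR. Qed.
Lemma innerZr (a : R[i]) x y : inner x (a *: y) = a^* * inner x y.
Proof. exact: linearZr_LR. Qed.
Lemma innerC x y : inner x y = (inner y x)^*.
Proof. by rewrite [LHS](hermC inner) expr0 mul1r. Qed.

Lemma inner_inj x y : (forall z, inner z x = inner z y) -> x = y.
Proof.
move=> xy; apply/eqP; rewrite -subr_eq0 -(dnorm_eq0 inner).
by rewrite innerBr xy subrr.
Qed.

Lemma inner_cauchy_schwarz x y : `|inner x y| <= `|x| * `|y|.
Proof.
have [->|y0] := eqVneq y 0; first by rewrite linear0r !normr0 mulr0.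
have yy0 : `|y| ^+ 2 != 0 by rewrite expf_neq0 // normr_eq0.
have := dnorm_ge0 inner (x - (inner x y / `|y| ^+ 2) *: y).
rewrite dnormB dnormZ innerZr -!innerE [(_ / _)^*]rmorphM fmorphV /=.
rewrite (conj_Creal (_ : `|y| ^+ 2 \is Num.real)) ?realX ?normr_real//.
have -> : (inner x y)^* / `|y| ^+ 2 * inner x y = `|inner x y| ^+ 2 / `|y| ^+ 2.
  by rewrite normCK mulrAC [(inner x y)^* * _]mulrC.
rewrite conj_Creal ?realM ?realV ?realX ?normr_real//.
rewrite normf_div normrX normr_id.
set a := `|inner x y|; rewrite [X in 0 <= X](_ : _ = `|x| ^+ 2 - a ^+ 2 / `|y| ^+ 2).
  rewrite subr_ge0 ler_pdivrMr ?exprn_gt0 ?normr_gt0// -exprMn.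
  by rewrite ler_sqr ?nnegrE /a ?mulr_ge0 ?normr_ge0.
by field; rewrite normr_eq0.
Qed.

(* Inverse naturals are eventually below every positive element of R[i]. *)
Lemma invnS_small (e : R[i]) : 0 < e -> exists N, N.+1%:R^-1 < e :> R[i].
Proof.
move=> e0; have ereal : e \is Num.real by rewrite ger0_real// ltW.
have e'0 : 0 < complex.Re e by rewrite -ltcR RRe_real.
exists (Num.truncn (complex.Re e)^-1).
rewrite -(RRe_real ereal) invf_plt ?posrE ?ltcR// ?ltr0n//.
by rewrite -fmorphV -(rmorph_nat (real_complex R)) ltcR truncnS_gt.
Qed.

(* Riesz representation: the representing vector is the limit of a minimizing
   sequence of x |-> |x|^2 - 2 Re (phi x). *)
Section Functional.
Variables (phi : H -> R[i]) (M : R[i]).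
Hypothesis phi_lin : forall (a : R[i]) x y, phi (a *: x + y) = a * phi x + phi y.
Hypothesis phi_bnd : forall x, `|phi x| <= M * `|x|.

Let phi0 : phi 0 = 0.
Proof. by have := phi_lin (-1) 0 0; rewrite scaleN1r oppr0 addr0 mulN1r addNr. Qed.
Let phiZ (a : R[i]) x : phi (a *: x) = a * phi x.
Proof. by rewrite -[a *: x]addr0 phi_lin phi0 addr0. Qed.
Let phiD x y : phi (x + y) = phi x + phi y.
Proof. by rewrite -[x]scale1r phi_lin mul1r scale1r. Qed.

Let J x := `|x| ^+ 2 - (phi x + (phi x)^*).

Let J_real x : J x \is Num.real.
Proof.
rewrite rpredB ?realX ?normr_real//; apply/CrealP.
by rewrite rmorphD /= conjCK addrC.
Qed.

Let J_inf : exists d : R[i], (forall x, d <= J x) /\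
  forall n : nat, exists x, J x < d + n.+1%:R^-1.
Proof.
pose E := range (fun x => complex.Re (J x)).
have hE : has_inf E.
  split; first by exists (complex.Re (J 0)), 0.
  exists (complex.Re (- (`|M| ^+ 2))) => _ [x _ <-].
  rewrite -lecR !RRe_real// ?rpredN ?realX ?normr_real//.
  rewrite -subr_ge0 opprK.
  have phire : phi x + (phi x)^* <= 2 * (`|M| * `|x|).
    have r : phi x + (phi x)^* \is Num.real.
      by apply/CrealP; rewrite rmorphD /= conjCK addrC.
    rewrite (le_trans (real_ler_norm r))// (le_trans (ler_normD _ _))//.
    suff phix : `|phi x| <= `|M| * `|x|.
      by rewrite norm_conjC mulr_natl mulr2n lerD.
    rewrite (le_trans (phi_bnd x))//.
    have [->|x0] := eqVneq x 0; first by rewrite normr0 !mulr0.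
    have M0 : 0 <= M.
      by rewrite -(pmulr_lge0 _ (_ : 0 < `|x|)) ?normr_gt0// (le_trans _ (phi_bnd x)).
    by rewrite (ger0_norm M0).
  have sq : 0 <= (`|x| - `|M|) ^+ 2 by rewrite real_exprn_even_ge0 ?rpredB ?normr_real.
  apply: (le_trans sq); rewrite -subr_ge0.
  rewrite [X in 0 <= X](_ : _ = 2 * (`|M| * `|x|) - (phi x + (phi x)^*)) ?subr_ge0//.
  by rewrite /J; ring.
exists (real_complex R (inf E)); split=> [x|n].
  by rewrite -(RRe_real (J_real x)) lecR ge_inf//; [case: hE|exists x].
have n0 : 0 < n.+1%:R^-1 :> R by rewrite invr_gt0 ltr0n.
have [_ [x _ <-] xE] := inf_adherent n0 hE.
exists x; move: xE; rewrite -ltcR RRe_real// => /lt_le_trans; apply.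
by rewrite rmorphD fmorphV rmorph_nat.
Qed.

Let J_mid d x y : (forall z, d <= J z) ->
  `|x - y| ^+ 2 <= 2 * ((J x - d) + (J y - d)).
Proof.
move=> /(_ (2^-1 *: (x + y))) dJ.
have h2 : `|2^-1| = 2^-1 :> R[i] by rewrite ger0_norm// invr_ge0 ler0n.
have h3 : (2^-1)^* = 2^-1 :> R[i] by rewrite fmorphV rmorph_nat.
rewrite -subr_ge0 [X in 0 <= X](_ : _ = 4 * (J (2^-1 *: (x + y)) - d)).
  by rewrite mulr_ge0 ?subr_ge0.
rewrite /J phiZ phiD normrZ h2 !(rmorphM, rmorphD) /= h3 exprMn !innerE dnormB dnormD.
by rewrite -!innerE; field.
Qed.

Let J_step x (d e : R[i]) h : (forall z, d <= J z) -> J x < d + e ->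
  `|inner h x - phi h| ^+ 2 <= e * (`|h| ^+ 2 + 1).
Proof.
move=> dJ Jx; set w := inner h x - phi h.
have h1 : 0 < `|h| ^+ 2 + 1 by rewrite ltr_wpDl// exprn_ge0.
have hr : (`|h| ^+ 2 + 1)^* = `|h| ^+ 2 + 1 by apply/conj_Creal/gtr0_real.
pose c := - ((`|h| ^+ 2 + 1)^-1 * w^*).
have wE : `|w| ^+ 2 = w * w^* by rewrite normCK.
have cE : c^* = - ((`|h| ^+ 2 + 1)^-1 * w).
  by rewrite rmorphN rmorphM fmorphV /= hr conjCK.
have JE : J (x + c *: h) = J x
    - (2 / (`|h| ^+ 2 + 1) - `|h| ^+ 2 / (`|h| ^+ 2 + 1) ^+ 2) * `|w| ^+ 2.
  have hx : inner h x = w + phi h by rewrite /w subrK.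
  have E1 : (phi x + c * phi h)^* = (phi x)^* + c^* * (phi h)^*.
    by rewrite rmorphD rmorphM.
  have E2 : (c^* * (w + phi h)^*)^* = c * (w + phi h).
    by rewrite rmorphM /= !conjCK.
  have E3 : (w + phi h)^* = w^* + (phi h)^* by rewrite rmorphD.
  rewrite /J phiD phiZ innerE dnormD dnormZ innerZr -!innerE normCK (innerC x h).
  rewrite hx E1 E2 E3 cE wE /c.
  by field; rewrite gt_eqF.
have := lt_le_trans Jx (_ : d + e <= J (x + c *: h) + e).
rewrite lerD2r dJ => /(_ isT) {}Jx; move: Jx; rewrite JE.
set s := `|w| ^+ 2; set t := `|h| ^+ 2 + 1 => Jx.
have : (2 / t - `|h| ^+ 2 / t ^+ 2) * s < e.
  by move: Jx; rewrite -addrA ltrDl addrC subr_gt0.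
move=> /ltW se; rewrite -ler_pdivrMr//; apply: le_trans se.
rewrite mulrC ler_wpM2r ?exprn_ge0// -subr_ge0.
rewrite [X in 0 <= X](_ : _ = t^-1 ^+ 2); first by rewrite exprn_ge0// invr_ge0 ltW.
by rewrite (_ : `|h| ^+ 2 = t - 1) ?/t ?addrK//; field; rewrite gt_eqF.
Qed.

Lemma riesz : exists z, forall x, phi x = inner x z.
Proof.
have [d [dJ /choice[u uJ]]] := J_inf.
have uJ' n : J (u n) - d <= n.+1%:R^-1 by rewrite lerBlDl ltW.
have cu : cauchy (u @ \oo).
  apply: cauchy_exP => e e0.
  have [N Ne] : exists N, N.+1%:R^-1 < e ^+ 2 / 4 :> R[i].
    by apply: invnS_small; rewrite divr_gt0 ?exprn_gt0.
  exists (u N); exists N => //= n /= Nn; rewrite -ball_normE /ball_ /=.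
  rewrite -ltr_sqr ?nnegrE ?normr_ge0 ?(ltW e0)//.
  apply: (le_lt_trans (J_mid _ _ dJ)); rewrite -ltr_pdivlMl//.
  apply: (@le_lt_trans _ _ (2 * N.+1%:R^-1)).
    rewrite mulr_natl mulr2n lerD// (le_trans (uJ' n))//.
    by rewrite lef_pV2 ?posrE ?ltr0n// ler_nat.
  by rewrite -ltr_pdivlMl// (lt_le_trans Ne)// le_eqVlt; apply/orP; left; apply/eqP; field.
have /cvg_ex[z uz] : cvg (u @ \oo) by exact: cauchy_cvg.
exists z => h; apply/esym/eqP; rewrite -subr_eq0 -normr_le0.
set w := inner h z - phi h.
have le_e (e : R[i]) : 0 < e -> `|w| <= (`|h| + 1) * e.
  move=> e0; have h1 : 0 < `|h| ^+ 2 + 1 by rewrite ltr_wpDl// exprn_ge0.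
  have [N Ne] : exists N, N.+1%:R^-1 < e ^+ 2 / (`|h| ^+ 2 + 1) :> R[i].
    by apply: invnS_small; rewrite divr_gt0 ?exprn_gt0.
  have /cvgrPdist_lt/(_ e e0) [N' _ uN'] := uz.
  have := uN' (maxn N N') (leq_maxr _ _); set n := maxn N N' => /= zu.
  have -> : w = inner h (z - u n) + (inner h (u n) - phi h).
    by rewrite innerBr addrA subrK.
  rewrite (le_trans (ler_normD _ _))// mulrDl mul1r lerD//.
    by rewrite (le_trans (inner_cauchy_schwarz _ _))// ler_wpM2l// ltW.
  rewrite -ler_sqr ?nnegrE ?(ltW e0)// (le_trans (J_step _ dJ (uJ n)))//.
  rewrite -ler_pdivlMr// (le_trans _ (ltW Ne))//.
  by rewrite lef_pV2 ?posrE ?ltr0n// ler_nat ltnS leq_maxl.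
rewrite real_leNgt ?normr_real//; apply/negP => w0.
have h0 : 0 < `|h| + 1 by rewrite ltr_wpDl.
have := le_e (`|w| / (`|h| + 1) / 2); rewrite !divr_gt0// => /(_ isT).
rewrite [leRHS](_ : _ = `|w| / 2); last by field; rewrite gt_eqF.
by rewrite ler_pdivlMr// ger_pMr// (ler_nat _ 2 1).
Qed.

End Functional.
End Riesz.

Section Adjoint.
Variables (R : realType) (H : hilbertType R).
Implicit Types (S T : bop H).

Definition is_adjoint T S := forall x y : H, inner (T x) y = inner x (S y).

Lemma is_adjoint_ex T : exists S, is_adjoint T S.
Proof.
have /bounded_linearP[lT [M M0 TM]] := valP T.
have Ty (y : H) : exists z, forall x, inner (T x) y = inner x z.
  apply: (@riesz R H _ (M * `|y|)) => [a x x'|x].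
    by rewrite linearP innerDl innerZl.
  rewrite (le_trans (inner_cauchy_schwarz _ _))// mulrAC ler_wpM2r//.
  exact: TM.
have [S TS] := choice Ty.
have Sbl : S \in @bounded_linear R H.
  apply/bounded_linearP; split=> [a y y'|].
    apply: inner_inj => x.
    by rewrite -TS !innerDr !innerZr !TS.
  exists M => // y; have [->|Sy0] := eqVneq (S y) 0.
    by rewrite normr0 mulr_ge0.
  have SyE : `|S y| * `|S y| = `|inner (T (S y)) y|.
    by rewrite TS -innerE ger0_norm ?exprn_ge0.
  rewrite -(ler_pM2r (_ : 0 < `|S y|)) ?normr_gt0// SyE.
  rewrite (le_trans (inner_cauchy_schwarz _ _))// mulrAC ler_wpM2r//.
  exact: TM.
by exists (BOp Sbl).
Qed.

Definition adjoint T : bop H := xget 0 (is_adjoint T).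

Lemma adjointP T : is_adjoint T (adjoint T).
Proof. exact: (xgetPex 0 (is_adjoint_ex T)). Qed.

End Adjoint.

Section Drazin.
Variables (R : realType) (H : hilbertType R).
Implicit Types (S T X Y : bop H).

Definition commutator X Y : bop H := X * Y - Y * X.

Definition is_drazin_inverse T S : Prop :=
  [/\ commutator S T = 0, S ^+ 2 * T = S &
      exists2 p : nat, (1 <= p)%N & T ^+ p.+1 * S = T ^+ p].

Definition drazin_invertible T : Prop := exists S, is_drazin_inverse T S.

Lemma is_drazin_inverse_unique T S S' :
  is_drazin_inverse T S -> is_drazin_inverse T S' -> S = S'.
Proof.
have pow U n : is_drazin_inverse T U -> U = U ^+ n.+1 * T ^+ n.
  move=> [_ UE _]; elim: n => [|n IH]; first by rewrite expr1 mulr1.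
  have UE' : U ^+ n.+1 = U ^+ n.+2 * T by rewrite -(addn2 n) exprD -mulrA UE -exprSr.
  by rewrite {1}IH UE' (exprS T) mulrA.
move=> dS dS'; have [/subr0_eq cS _ [p _ pS]] := dS.
have [/subr0_eq cS' _ [q _ qS']] := dS'.
have -> : S = S * T * S'.
  by rewrite {1}(pow S q dS) -qS' (exprSr T) !mulrA -(pow S q dS).
have comm U n k : U * T = T * U -> U ^+ n * T ^+ k = T ^+ k * U ^+ n.
  by move=> UT; apply/commrX/commr_sym/commrX/commr_sym.
rewrite [RHS](pow S' p dS') comm// -pS -[T ^+ p.+1 * S](comm S 1%N p.+1 cS) expr1.
by rewrite (exprS T) mulrA -(mulrA (S * T)) -(comm S')// -(pow S' p dS').
Qed.

Definition drazin_inverse T : bop H := xget 0 (is_drazin_inverse T).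

Lemma drazin_inverseP T :
  drazin_invertible T -> is_drazin_inverse T (drazin_inverse T).
Proof. exact: xgetPex. Qed.

(* T is in the class [(r,s)DN]; used for r, s >= 1. *)
Definition DN (r s : nat) T : Prop := drazin_invertible T /\
  commutator (drazin_inverse T ^+ r) (adjoint T ^+ s) = 0.

End Drazin.

(* Main.v *)
(* Write S for the Drazin inverse of T and P = S T for the associated idempotent.
   Whatever commutes with an operator commutes with its Drazin inverse. The operator S is
   itself Drazin invertible, with inverse U = T^2 S and S = S^(n+1) U^n; hence an
   operator commuting with S^n and S^(n+1) commutes with S, which gives (i).
   For (ii), X = S^n commutes with T^*m, hence with S^*m and with
   P^* = S^*m T^*m. As X and P have the same range and kernel, P^* preserves both,
   i.e. P is normal, so P is an orthogonal projection. Since X = X P = P X,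
   commuting with T^* amounts to commuting with T^* P = T^*(m+1) S^*m. *)
Require Import Defs.
From mathcomp Require Import all_boot all_order all_algebra.
From mathcomp Require Import reals.

Set Implicit Arguments.
Unset Strict Implicit.
Unset Printing Implicit Defensive.

Import GRing.Theory Num.Theory.
Local Open Scope ring_scope.

Section RingDrazin.
Variable A : pzRingType.
Implicit Types s t x : A.

(** Purely algebraic form of the Drazin relations. The index [p] may be 0, which is the case of
    invertible [t]. *)
Definition ring_drazin t s : Prop :=
  [/\ GRing.comm s t, s ^+ 2 * t = s & exists p, t ^+ p.+1 * s = t ^+ p].

Lemma ring_drazin_mulM t s : ring_drazin t s -> s * (s * t) = s.
Proof. by case=> _ sst _; rewrite mulrA -expr2. Qed.

Lemma ring_drazin_Mmul t s : ring_drazin t s -> s * t * s = s.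
Proof. by case=> st sst _; rewrite -mulrA -st mulrA -expr2. Qed.

Lemma ring_drazin_Mpow t s n : ring_drazin t s -> (s * t) ^+ n.+1 = s * t.
Proof.
move=> ts; elim: n => [|n IH]; first by rewrite expr1.
by rewrite exprSr IH mulrA (ring_drazin_Mmul ts).
Qed.

Lemma ring_drazin_powM t s n : ring_drazin t s -> s ^+ n.+1 * t ^+ n.+1 = s * t.
Proof. by move=> ts; case: (ts) => st _ _; rewrite -exprMn_comm// ring_drazin_Mpow. Qed.

Lemma ring_drazinX t s n : ring_drazin t s -> ring_drazin (t ^+ n) (s ^+ n).
Proof.
case: n => [|n] ts.
  by split; rewrite ?expr0 ?expr1n ?mulr1//; exists 0%N; rewrite !expr0 mulr1.
have [st _ [p tp]] := ts.
have stX i j : GRing.comm (s ^+ i) (t ^+ j) by exact/commrX/commr_sym/commrX/commr_sym.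
split=> //.
  rewrite expr2 -mulrA ring_drazin_powM// {1}(exprSr s) -mulrA.
  by rewrite ring_drazin_mulM// -exprSr.
(* The index [p] of [t] still serves for its powers: [t ^+ (n.+1 * p)] contains the factor [t ^+ p],
   which absorbs [t * s]. *)
exists p; rewrite [_ ^+ p.+1]exprSr -mulrA -stX ring_drazin_powM//.
by rewrite -exprM mulSnr exprD st -!mulrA (mulrA (t ^+ p)) -exprSr tp.
Qed.

(** The point is that [x] commutes with the idempotent [P = s * t]; then [x s = P x s = s x t s = s
    x P = s P x = s x]. *)
Lemma ring_drazin_comm t s x : ring_drazin t s -> GRing.comm x t -> GRing.comm x s.
Proof.
move=> ts xt; have [st _ [p tp]] := ts.
have xP : GRing.comm x (s * t).
  case: p tp => [|p] tp; first by rewrite st -[t]expr1 tp; exact: commr1.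
  set q := p.+1 in tp.
  have xtq : GRing.comm x (t ^+ q) by exact: commrX.
  have sq : s ^+ q * t ^+ q = s * t by exact: ring_drazin_powM.
  have tq : t ^+ q * s ^+ q = s * t.
    by rewrite -sq; exact/commrX/commr_sym/commrX/commr_sym.
  have tqP : t ^+ q * (s * t) = t ^+ q by rewrite st mulrA -exprSr.
  have Ptq : s * t * t ^+ q = t ^+ q.
    by rewrite -[RHS]tqP; apply/commrX/commr_sym/commrM => //; exact: commr_sym.
  have xPE : x * (s * t) = t ^+ q * (x * s ^+ q) by rewrite -tq mulrA xtq mulrA.
  have PxE : s * t * x = s ^+ q * x * t ^+ q by rewrite -sq -mulrA -xtq mulrA.
  (* Both [x P] and [P x] equal [P x P]: the first has [t ^+ q] as left factor, the second as right
     factor, and [P] fixes [t ^+ q] on either side. *)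
  transitivity (s * t * x * (s * t)).
    by rewrite -mulrA xPE (mulrA (s * t)) Ptq.
  by rewrite PxE -mulrA tqP.
rewrite /GRing.comm -{1}(ring_drazin_Mmul ts) mulrA xP -!mulrA (mulrA t) -xt.
by rewrite -!mulrA -st xP mulrA ring_drazin_mulM.
Qed.

Lemma ring_drazin_inv t s : ring_drazin t s -> ring_drazin s (t * (s * t)).
Proof.
move=> ts; have [st _ _] := ts.
have su : s * (t * (s * t)) = s * t by rewrite mulrA mulrA (ring_drazin_Mmul ts).
have us : t * (s * t) * s = s * t by rewrite -mulrA (ring_drazin_Mmul ts).
split; first by rewrite /GRing.comm su us.
  by rewrite expr2 -mulrA us -mulrA -expr2 ring_drazin_Mpow.
by exists 1%N; rewrite expr2 -mulrA su expr1 ring_drazin_mulM.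
Qed.

Lemma ring_drazin_comm_succ t s n x : ring_drazin t s ->
  GRing.comm x (s ^+ n) -> GRing.comm x (s ^+ n.+1) -> GRing.comm x s.
Proof.
move=> ts xn xn1; set u := t * (s * t).
have xu : GRing.comm x (u ^+ n).
  exact: ring_drazin_comm (ring_drazinX n (ring_drazin_inv ts)) xn.
suff <- : s ^+ n.+1 * u ^+ n = s by exact: commrM.
have [us _ _] := ring_drazin_inv ts.
(* Here [s ^+ n.+1 * u ^+ n = s * (s * u) ^+ n], and [s * u] is the idempotent [s * t]. *)
rewrite exprS -mulrA -exprMn_comm; last exact: commr_sym.
rewrite /u mulrA mulrA (ring_drazin_Mmul ts).
case: n {xn xn1 xu} => [|n]; first by rewrite mulr1.
by rewrite (ring_drazin_Mpow _ ts) ring_drazin_mulM.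
Qed.

End RingDrazin.

Section BoundedOperators.
Variables (R : realType) (H : hilbertType R).
Implicit Types S T X Y : bop H.

Lemma commutator0P X Y : commutator X Y = 0 <-> GRing.comm X Y.
Proof. by split=> [/subr0_eq|XY]; last by rewrite /commutator XY subrr. Qed.

Lemma adjoint_unique T S : is_adjoint T S -> adjoint T = S.
Proof. by move=> TS; apply/bop_ext => y; apply: inner_inj => x; rewrite -TS adjointP. Qed.

Lemma adjointK T : adjoint (adjoint T) = T.
Proof. by apply: adjoint_unique => x y; rewrite innerC -adjointP -innerC. Qed.

Lemma adjointM S T : adjoint (S * T) = adjoint T * adjoint S.
Proof. by apply: adjoint_unique => x y; rewrite !bopM !adjointP. Qed.

Lemma adjoint1 : adjoint (1 : bop H) = 1.
Proof. by apply: adjoint_unique => x y; rewrite !bop1. Qed.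

Lemma adjointB S T : adjoint (S - T) = adjoint S - adjoint T.
Proof.
apply: adjoint_unique => x y.
have subE (U V : bop H) z : (U - V) z = U z - V z by [].
by rewrite !subE innerBr linearBl; congr (_ - _); exact: adjointP.
Qed.

Lemma adjointX T n : adjoint (T ^+ n) = adjoint T ^+ n.
Proof.
by elim: n => [|n IH]; rewrite ?expr0 ?adjoint1// exprS adjointM IH -exprSr.
Qed.

(** This rests on [|T x|^2 = <x, T^* T x>]. *)
Lemma adjoint_mul_eq0 T : adjoint T * T = 0 -> T = 0.
Proof.
move=> TT0; apply/bop_ext => x; apply/eqP.
rewrite -normr_eq0 -sqrf_eq0 innerE adjointP -bopM TT0.
by rewrite linear0r.
Qed.

(** With [Q = P^*], normality makes the adjoint of [Q - Q P] equal to [P (1 - Q)], which kills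
    [Q (1 - P)]. Hence [Q = Q P = P^* P] is self-adjoint. *)
Lemma normal_idempotent_adjoint (P : bop H) :
  P * P = P -> GRing.comm P (adjoint P) -> adjoint P = P.
Proof.
move=> PP nP; set Q := adjoint P in nP *.
have QQ : Q * Q = Q by rewrite -adjointM PP.
suff /subr0_eq QE : Q - Q * P = 0 by rewrite -[RHS]adjointK -/Q {2}QE adjointM adjointK.
apply: adjoint_mul_eq0; rewrite adjointB adjointM adjointK -/Q -{1}nP.
by rewrite mulrBl !mulrBr -!mulrA (mulrA Q Q) QQ subrr.
Qed.

Lemma is_drazin_inverse_ring T S : is_drazin_inverse T S -> ring_drazin T S.
Proof. by case=> /commutator0P ST SST [p _ Tp]; split=> //; exists p. Qed.

Lemma ring_drazin_adjoint T S : ring_drazin T S -> ring_drazin (adjoint T) (adjoint S).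
Proof.
case=> ST SST [p Tp].
have STX n : GRing.comm S (T ^+ n) by exact: commrX.
split; first by rewrite /GRing.comm -!adjointM ST.
  by rewrite -adjointX -adjointM -[in RHS]SST -(commrX 2 (commr_sym ST)).
by exists p; rewrite -!adjointX -adjointM STX Tp.
Qed.

Lemma comm_drazin_adjoint T S n m : ring_drazin T S -> (0 < n)%N -> (0 < m)%N ->
  GRing.comm (S ^+ n) (adjoint T ^+ m) -> GRing.comm (S ^+ n) (adjoint T ^+ m.+1) ->
  GRing.comm (S ^+ n) (adjoint T).
Proof.
move=> TS n0 m0 Xm Xm1; have [ST _ _] := TS.
set P := S * T; set Q := adjoint P; set X := S ^+ n in Xm Xm1 *.
have TS' := ring_drazin_adjoint TS; have [ST' _ _] := TS'.
have XS' : GRing.comm X (adjoint S ^+ m) by exact: ring_drazin_comm (ring_drazinX m TS') Xm.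
have QE : Q = adjoint S * adjoint T by rewrite ST' /Q adjointM.
have XQ : GRing.comm X Q.
  by rewrite QE -(ring_drazin_powM m.-1 TS') prednK//; exact: commrM.
have XP : X * P = X.
  by rewrite /X -(prednK n0) exprSr -mulrA ring_drazin_mulM.
have PX : P * X = X.
  by rewrite /X -(prednK n0) exprS mulrA ring_drazin_Mmul.
have PXT : P = X * T ^+ n by rewrite /X -(prednK n0) (ring_drazin_powM _ TS).
have PTX : P = T ^+ n * X.
  by rewrite PXT; apply/commrX/commr_sym/commrX/commr_sym.
have PP : P * P = P by rewrite {2}PXT mulrA PX.
have PQ : GRing.comm P Q.
  (* [P = T^n X] gives [P Q = T^n Q X = T^n Q X P = P Q P]; symmetrically, [P = X T^n] gives
     [Q P = P Q P]. *)
  transitivity (P * Q * P).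
    by rewrite {1}PTX -mulrA XQ -{1}XP (mulrA Q) -XQ !mulrA -PTX.
  by rewrite {2}PXT mulrA -(mulrA P) -XQ mulrA PX XQ -mulrA -PXT.
have QP : Q = P := normal_idempotent_adjoint PP PQ.
have XQT : GRing.comm X (Q * adjoint T).
  have -> : Q * adjoint T = adjoint S ^+ m * adjoint T ^+ m.+1.
    by rewrite exprSr mulrA -(prednK m0) (ring_drazin_powM _ TS') QE.
  exact: commrM.
have TQ : GRing.comm (adjoint T) Q by rewrite QE; apply: commrM => //; exact: commr_sym.
(* Since [Q = P], the factor [Q] is absorbed by [X] on either side. *)
transitivity (X * (Q * adjoint T)); first by rewrite mulrA QP XP.
by rewrite XQT -TQ -mulrA QP PX.
Qed.

End BoundedOperators.

Theorem proposition2p5 (R : realType) (H : hilbertType R)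
    (Hinf : infinite_dimensional H) (n m : nat) (n1 : (1 <= n)%N)
    (m1 : (1 <= m)%N) (T : bop H) (TD : drazin_invertible T) :
  (DN n m T /\ DN n.+1 m T <-> forall k : nat, (1 <= k)%N -> DN k m T) /\
  (DN n m T /\ DN n m.+1 T <-> forall k : nat, (1 <= k)%N -> DN n k T).
Proof.
have TS := is_drazin_inverse_ring (drazin_inverseP TD).
split; split=> [[[_ /commutator0P cn] [_ /commutator0P cn1]] k _|]; try by move=> h; split; apply: h.
  (* The commuting element is [x = T^*m]: it commutes with the Drazin inverse, hence with all its
     powers. *)
  split=> //; apply/commutator0P/commr_sym/commrX.
  exact: ring_drazin_comm_succ TS (commr_sym cn) (commr_sym cn1).
by split=> //; apply/commutator0P/commrX; exact: comm_drazin_adjoint TS n1 m1 cn cn1.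
Qed.
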